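(* Let $T$ be the tessellation of $\mathbb{R}^k$ given by a lattice. If $\chi(T)$ is refinable, then $T$ contains, for every facet $f$ of $T$, the whole plane of the same dimension that contains $f$; that is, the hyperplane spanned by $f$ is a union of facets of $T$.
   Context: A lattice $L$ in $\mathbb{R}^k$ is a discrete subgroup of full rank; it is identified with the tessellation $T$ of $\mathbb{R}^k$ by its Voronoi cells, i.e. the translates $V+l$, $l\in L$, of $V=\{x: |x|\le |x-l'| \text{ for all } l'\in L\}$. A facet of $T$ is a $(k-1)$-dimensional face of a cell of $T$. For $\lambda>0$, $\lambda T=\{\lambda c : c\in T\}$. $\chi(T)$ denotes the space of indicator functions of the cells of $T$. $\chi(T)$ is refinable if, for some fixed $0<\lambda<1$, the indicator function of every cell of $T$ is a linear combination of indicator functions of cells of the smaller-scale copy $\lambda T$. Linear combinations may be infinite (the sums are locally finite), and equality of functions is understood almost everywhere. *)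

(* Defs.v *)
From mathcomp Require Import all_boot all_order all_algebra.
From mathcomp Require Import all_classical all_reals all_analysis.
Import Order.TTheory GRing.Theory Num.Theory.
Import numFieldNormedType.Exports.

Set Implicit Arguments.
Unset Strict Implicit.
Unset Printing Implicit Defensive.

Local Open Scope classical_set_scope.
Local Open Scope ring_scope.

(* The canonical norm `|x| on 'rV[R]_k is the sup norm, so the Euclidean
   structure is introduced separately; both induce the same topology. *)
Definition dotv (R : realType) (k : nat) (x y : 'rV[R]_k) : R :=
  \sum_(i < k) x 0 i * y 0 i.

Definition enorm (R : realType) (k : nat) (x : 'rV[R]_k) : R :=
  Num.sqrt (dotv x x).

Definition is_lattice (R : realType) (k : nat) (L : set 'rV[R]_k) : Prop :=
  [/\ zmod_closed (mem L),
      L `<=` isolated L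
    & exists2 X : seq 'rV[R]_k, [set` X] `<=` L & <<X>>%VS = fullv].

Definition voronoi (R : realType) (k : nat) (L : set 'rV[R]_k) : set 'rV[R]_k :=
  [set x | forall l, L l -> enorm x <= enorm (x - l)].

(* A tessellation is represented by the set of its cells. *)
Definition tessellation (R : realType) (k : nat) (L : set 'rV[R]_k) :
    set (set 'rV[R]_k) :=
  [set [set v + l | v in voronoi L] | l in L].

Definition scale_tess (R : realType) (k : nat) (lambda : R)
    (T : set (set 'rV[R]_k)) : set (set 'rV[R]_k) :=
  [set [set lambda *: x | x in c] | c in T].

(* Lebesgue null sets of R^k.  Covers are indexed by an arbitrary D : set nat,
   so that finite and empty covers are allowed. *)
Definition lebesgue_null (R : realType) (k : nat) (N : set 'rV[R]_k) : Prop :=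
  forall e : R, 0 < e ->
  exists (D : set nat) (a b : nat -> 'rV[R]_k),
    [/\ forall n i, a n 0 i <= b n 0 i,
        N `<=` \bigcup_(n in D) [set x | forall i, a n 0 i <= x 0 i <= b n 0 i]
      & (\esum_(n in D) (\prod_(i < k) (b n 0 i - a n 0 i))%:E <= e%:E)%E].

Definition ae_eq_fun (R : realType) (k : nat) (f g : 'rV[R]_k -> R) : Prop :=
  lebesgue_null [set x | f x != g x].

(* For each x the sum over the cells d of lambda T is the finitely supported sum
   \sum_(d \in _) of fsbigop: when T comes from a lattice, only finitely many
   cells of lambda T contain x, and the other terms vanish. *)
Definition refinable (R : realType) (k : nat) (T : set (set 'rV[R]_k)) : Prop :=
  exists lambda : R, 0 < lambda < 1 /\
  forall c, T c -> exists a : set 'rV[R]_k -> R,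
    ae_eq_fun \1_c (fun x => \sum_(d \in scale_tess lambda T) a d * \1_d x).

Definition affine_hull (R : realType) (k : nat) (A : set 'rV[R]_k) :
    set 'rV[R]_k :=
  [set x | exists (n : nat) (t : 'I_n -> R) (y : 'I_n -> 'rV[R]_k),
     [/\ forall i, A (y i), \sum_i t i = 1 & x = \sum_i t i *: y i]].

Definition has_affine_dim (R : realType) (k : nat) (A : set 'rV[R]_k) (d : nat) :
    Prop :=
  exists (p : 'rV[R]_k) (U : {vspace 'rV[R]_k}),
    \dim U = d /\ affine_hull A = [set x | x - p \in U].

(* Intersection of c with a supporting hyperplane; the degenerate choice
   u = 0 also yields c itself and the empty set. *)
Definition is_face (R : realType) (k : nat) (c F : set 'rV[R]_k) : Prop :=
  exists (u : 'rV[R]_k) (b : R),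
    (forall x, c x -> dotv u x <= b) /\ F = c `&` [set x | dotv u x = b].

Definition facets (R : realType) (k : nat) (T : set (set 'rV[R]_k)) :
    set (set 'rV[R]_k) :=
  [set F | exists2 c, T c &
     is_face c F /\ exists2 d, has_affine_dim F d & d.+1 = k].

(* Main.v *)
(* Let S be the union of the boundaries of the cells.  Each cell of lambda T has
   connected interior, on which the indicator functions of the cells of T are
   almost everywhere constant; hence S is contained in lambda S, that is,
   lambda^-1 S is contained in S.  A facet is the intersection of two cells V + m
   and V + m', it spans their bisector, and it contains a relative neighbourhood in
   that bisector of some x0.  Dilating this neighbourhood by lambda^-n and
   translating its centre back into the bounded cell V, a limit point of the
   centres yields a whole hyperplane orthogonal to l = m' - m inside the closed
   set S.  A generic point argument shows that through each point of such a
   hyperplane passes the intersection of two cells V + p, V + p' with p' - p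
   parallel to l, and comparing with the width of V in direction l gives
   p' - p = l or -l.  So all these intersections are lattice translates of the
   given facet; therefore the bisector of m, m' is itself in S, and the same
   argument at each of its points covers it by translates of the facet. *)
Require Import Defs.
From mathcomp Require Import all_boot all_order all_algebra.
From mathcomp Require Import finmap.
From mathcomp Require Import all_classical all_reals all_analysis.
From mathcomp Require Import measurable_realfun.
From mathcomp Require Import ring lra.
Import Order.TTheory GRing.Theory Num.Theory.
Import numFieldNormedType.Exports.
Local Open Scope classical_set_scope.
Local Open Scope ring_scope.
Set Implicit Arguments.
Unset Strict Implicit.
Unset Printing Implicit Defensive.

(** * Nonempty open sets are not negligible *)

Lemma lebesgue_measure_segment (R : realType) (a b : R) :
  a <= b -> lebesgue_measure (`[a, b]%classic : set R) = (b - a)%:E.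
Proof.
move=> ab; rewrite lebesgue_measure_itv/= lte_fin.
by case: ltgtP ab => // ->; rewrite subrr.
Qed.

(* The weights make an induction on k possible: freezing the first coordinate at t
   turns them into w n * 1_[a n 0, b n 0](t), and the bound given by the
   induction hypothesis is then integrated over t. *)
Lemma box_cover_vol (R : realType) (k : nat) (w : nat -> R)
    (a b : nat -> 'I_k -> R) (c d : 'I_k -> R) :
  (forall n, 0 <= w n) -> (forall n i, a n i <= b n i) ->
  (forall i, c i <= d i) ->
  (forall x : 'I_k -> R, (forall i, c i <= x i <= d i) ->
    (1 <= \sum_(n <oo)
      (w n * \prod_i \1_(`[a n i, b n i]%classic : set R) (x i))%:E)%E) ->
  ((\prod_i (d i - c i))%:E <=
    \sum_(n <oo) (w n * \prod_i (b n i - a n i))%:E)%E.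
Proof.
elim: k w a b c d => [|k IH] w a b c d w0 ab cd cov.
  (* In dimension 0 all products are empty, and the covering hypothesis at the only point is the
     claim. *)
  have := cov (fun=> 0) (fun i => False_ind _ (notF (ltn_ord i))).
  rewrite big_ord0; under eq_eseriesr do rewrite big_ord0.
  by under [X in _ -> (_ <= X)%E]eq_eseriesr do rewrite big_ord0.
have P0 (n : nat) : 0 <= \prod_(i < k) (b n (lift ord0 i) - a n (lift ord0 i)).
  by apply: prodr_ge0 => i _; rewrite subr_ge0.
pose D : set R := `[c ord0, d ord0]%classic.
have slice (t : R) : D t ->
    ((\prod_(i < k) (d (lift ord0 i) - c (lift ord0 i)))%:E <= \sum_(n <oo)
      (w n * \prod_(i < k) (b n (lift ord0 i) - a n (lift ord0 i)) *
       \1_(`[a n ord0, b n ord0]%classic : set R) t)%:E)%E.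
  move=> Dt.
  have := IH (fun n => w n * \1_(`[a n ord0, b n ord0]%classic : set R) t)
    (fun n i => a n (lift ord0 i)) (fun n i => b n (lift ord0 i))
    (fun i => c (lift ord0 i)) (fun i => d (lift ord0 i)).
  under [X in _ -> (_ <= X)%E]eq_eseriesr do rewrite mulrAC.
  apply.
  - by move=> n; rewrite mulr_ge0.
  - by move=> n i.
  - by move=> i.
  move=> x xcd.
  pose y i := if unlift ord0 i is Some j then x j else t.
  have := cov y; under eq_eseriesr do rewrite big_ord_recl.
  rewrite (_ : y ord0 = t); last by rewrite /y unlift_none.
  under eq_eseriesr => n _.
    under eq_bigr do rewrite /y liftK.
    rewrite mulrA; over.
  apply=> i; rewrite /y; case: unliftP => [j ->//|->].
  by move: Dt; rewrite /D/= in_itv.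
rewrite big_ord_recl.
under eq_eseriesr do rewrite big_ord_recl mulrCA.
rewrite EFinM -lebesgue_measure_segment// -/D.
have mD : measurable D by exact: measurable_itv.
rewrite muleC -integral_cst; last exact: mD.
pose g (n : nat) (t : R) := w n *
  \prod_(i < k) (b n (lift ord0 i) - a n (lift ord0 i)) *
  \1_(`[a n ord0, b n ord0]%classic : set R) t.
have g0 n t : 0 <= g n t by rewrite !mulr_ge0.
have mg n : measurable_fun D (g n).
  apply: measurable_funM; first exact: measurable_cst.
  by apply: measurable_funTS; exact: measurable_indic.
have mgE n : measurable_fun D (EFin \o g n) by exact/measurable_EFinP.
(* The bound [slice] is integrated over [D]; nonnegativity of the terms then allows exchanging
   series and integral. *)
apply: (@le_trans _ _ (\int[lebesgue_measure]_(t in D) \sum_(n <oo) (g n t)%:E)%E).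
  apply: ge0_le_integral => //.
  - by move=> t _; apply: prodr_ge0 => i _; rewrite subr_ge0.
  - apply: ge0_emeasurable_sum => [n t _ _|n _]; first by rewrite lee_fin.
    exact: mgE.
rewrite integral_nneseries//; last first.
  by move=> n t _; rewrite lee_fin.
apply: lee_nneseries => n _.
  by move=> _; apply: integral_ge0 => t _; rewrite lee_fin.
under eq_integral do rewrite /g EFinM.
rewrite ge0_integralZl_EFin//=; last 2 first.
- by apply/measurable_EFinP/measurable_funTS; exact: measurable_indic.
- by rewrite mulr_ge0.
rewrite integral_indic// [leRHS]EFinM [leRHS]muleC; apply: lee_wpmul2l.
  by rewrite lee_fin mulr_ge0.
rewrite -lebesgue_measure_segment//; apply: le_measure => //; rewrite inE//.
exact: measurableI.
Qed.

(** The neighbourhood contains a closed cube of volume [v > 0], and every cover of it by boxes has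
    total volume at least [v]; nullity would supply one of total volume at most [v / 2]. *)
Lemma nbhs_not_lebesgue_null (R : realType) (k : nat) (x : 'rV[R]_k)
    (A : set 'rV[R]_k) :
  nbhs x A -> ~ lebesgue_null A.
Proof.
move=> /nbhs_ballP[r /= r0 rA] nullA.
pose s := r / 2.
have s0 : 0 < s by rewrite divr_gt0.
pose v := \prod_(i < k) ((x 0 i + s) - (x 0 i - s)).
have v0 : 0 < v by apply: prodr_gt0 => i _; lra.
have [|D [a [b [ab cov sum]]]] := nullA (v / 2); first by rewrite divr_gt0.
(* Weights 0 and 1 turn the sum over [D] into a series over all indices. *)
pose w n : R := \1_D n.
suff : (v%:E <= (v / 2)%:E)%E by rewrite lee_fin; lra.
apply: le_trans sum.
have -> : (\esum_(n in D) (\prod_(i < k) (b n 0 i - a n 0 i))%:E =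
    \sum_(n <oo) (w n * \prod_(i < k) (b n 0 i - a n 0 i))%:E)%E.
  rewrite nneseries_esumT; last first.
    by move=> n; rewrite lee_fin mulr_ge0// prodr_ge0// => i _; rewrite subr_ge0.
  rewrite [LHS]esum_mkcond; apply: eq_esum => n _.
  by rewrite /w indicE; case: ifP => _; rewrite ?mul1r ?mul0r.
apply: (@box_cover_vol _ _ w (fun n => a n 0) (fun n => b n 0)) => //.
  by move=> i; lra.
move=> y xy.
pose z : 'rV[R]_k := \row_i y i.
have Az : A z.
  apply: rA; rewrite -ball_normE/= /ball_/=.
  apply: (@le_lt_trans _ _ s); last by rewrite /s; lra.
  rewrite [leLHS]/Num.norm/= mx_normrE; apply/bigmax_leP; split; first exact: ltW.
  by move=> [i j] _ /=; rewrite !mxE ord1 ler_norml; have /andP[] := xy j; lra.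
have [n Dn nz] := cov _ Az.
rewrite (@nneseriesD1 _ _ n xpredT)//; last first.
  by move=> m _; rewrite lee_fin mulr_ge0// prodr_ge0.
rewrite {1}/w indicE mem_set// mul1r big1 => [|i _]; last first.
  by rewrite indicE mem_set//= in_itv/=; have := nz i; rewrite mxE.
rewrite leeDl//; apply: nneseries_ge0 => m _ _.
by rewrite lee_fin mulr_ge0// prodr_ge0.
Qed.

(** * Scalar product *)

Section Dot.
Variables (R : realType) (k : nat).
Implicit Types (x y z : 'rV[R]_k) (a : R).

Lemma dotvC x y : dotv x y = dotv y x.
Proof. by apply: eq_bigr => i _; rewrite mulrC. Qed.

Lemma dotvDl x y z : dotv (x + y) z = dotv x z + dotv y z.
Proof. by rewrite -big_split; apply: eq_bigr => i _; rewrite !mxE mulrDl. Qed.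

Lemma dotvZl a x z : dotv (a *: x) z = a * dotv x z.
Proof. by rewrite /dotv mulr_sumr; apply: eq_bigr => i _; rewrite !mxE mulrA. Qed.

Lemma dotvNl x z : dotv (- x) z = - dotv x z.
Proof. by rewrite -scaleN1r dotvZl mulN1r. Qed.

Lemma dot0v z : dotv 0 z = 0.
Proof. by rewrite -(scale0r 0) dotvZl mul0r. Qed.

Lemma dotvDr x y z : dotv x (y + z) = dotv x y + dotv x z.
Proof. by rewrite dotvC dotvDl !(dotvC x). Qed.

Lemma dotvZr a x z : dotv x (a *: z) = a * dotv x z.
Proof. by rewrite dotvC dotvZl (dotvC x). Qed.

Lemma dotvNr x z : dotv x (- z) = - dotv x z.
Proof. by rewrite dotvC dotvNl (dotvC x). Qed.

Lemma dotv0 z : dotv z 0 = 0.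
Proof. by rewrite dotvC dot0v. Qed.

Definition dotvE := (dotvDl, dotvDr, dotvNl, dotvNr, dotvZl, dotvZr).

Lemma dotv_suml (n : nat) (t : 'I_n -> R) (y : 'I_n -> 'rV[R]_k) z :
  dotv (\sum_i t i *: y i) z = \sum_i t i * dotv (y i) z.
Proof.
elim/big_ind2 : _ => [|_ u _ v <- <-|i _]; first exact: dot0v.
  by rewrite dotvDl.
by rewrite dotvZl.
Qed.

Lemma dotvv_ge0 x : 0 <= dotv x x.
Proof. by apply: sumr_ge0 => i _; rewrite -expr2 sqr_ge0. Qed.

Lemma dotvv_eq0 x : dotv x x = 0 -> x = 0.
Proof.
move=> /eqP; rewrite psumr_eq0 => [/allP xx0|i _]; last by rewrite -expr2 sqr_ge0.
apply/rowP => i; have := xx0 i (mem_index_enum _).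
by rewrite -expr2 sqrf_eq0 mxE => /eqP.
Qed.

Lemma dotvv_gt0 x : x != 0 -> 0 < dotv x x.
Proof.
rewrite lt0r dotvv_ge0 andbT; apply: contra_neq; exact: dotvv_eq0.
Qed.

Lemma coord_le_norm x i : `|x 0 i| <= `|x|.
Proof.
rewrite [leRHS]/Num.norm/= mx_normrE.
by apply/bigmax_geP; right => /=; exists (0, i).
Qed.

Lemma norm_leP x a : 0 <= a -> (forall i, `|x 0 i| <= a) -> `|x| <= a.
Proof.
move=> a0 xa; rewrite [leLHS]/Num.norm/= mx_normrE.
by apply/bigmax_leP; split => // -[i j] _; rewrite ord1/=.
Qed.

Lemma norm_ball_compact (r : R) : compact [set x : 'rV[R]_k | `|x| <= r].
Proof.
apply: bounded_closed_compact.
  exists r; split; first exact: num_real.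
  by move=> s rs x /= xr; apply: le_trans xr _; exact: ltW.
rewrite (_ : mkset _ = (fun x : 'rV[R]_k => `|x|) @^-1` [set t | t <= r])//.
by apply: preimage_closed (@closed_le _ r) => x _; exact: norm_continuous.
Qed.

Lemma sqr_norm_le_dotvv x : `|x| ^+ 2 <= dotv x x.
Proof.
rewrite -ler_sqrt ?dotvv_ge0// sqrtr_sqr normr_id.
apply: norm_leP => [|i]; first exact: sqrtr_ge0.
rewrite -sqrtr_sqr ler_sqrt ?dotvv_ge0// /dotv (bigD1 i)//= expr2 lerDl.
by apply: sumr_ge0 => j _; rewrite -expr2 sqr_ge0.
Qed.

Lemma dotvv_le_sqr_norm x : dotv x x <= `|x| ^+ 2 *+ k.
Proof.
rewrite -[X in _ *+ X]card_ord -sumr_const; apply: ler_sum => i _.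
by rewrite -expr2 -real_normK ?num_real// lerXn2r ?nnegrE// coord_le_norm.
Qed.

Lemma dotv_continuous (T : topologicalType) (f g : T -> 'rV[R]_k) :
  continuous f -> continuous g -> continuous (fun t => dotv (f t) (g t)).
Proof.
move=> cf cg t; apply: cvg_big => [|i _]; first exact: add_continuous.
apply: cvgM.
  exact: (continuous_comp (cf t) (@coord_continuous _ _ _ _ _ _)).
exact: (continuous_comp (cg t) (@coord_continuous _ _ _ _ _ _)).
Qed.

Definition sqdist x y : R := dotv (x - y) (x - y).

(** The terms quadratic in [x] cancel, so comparing the distances to two points is an affine
    condition on [x]. *)
Lemma sqdistB x y z : sqdist x y - sqdist x z =
  2 * dotv x (z - y) + dotv y y - dotv z z.
Proof.
rewrite /sqdist !dotvE (dotvC y x) (dotvC z x); ring.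
Qed.

Lemma enorm_le x y z : (enorm (x - y) <= enorm (x - z)) = (sqdist x y <= sqdist x z).
Proof. by rewrite ler_sqrt ?dotvv_ge0. Qed.

End Dot.

Lemma seq_argmin (T : eqType) (R : realDomainType) (f : T -> R) (s : seq T) (x : T) :
  x \in s -> exists2 m, m \in s & forall y, y \in s -> f m <= f y.
Proof.
elim: s x => // a s IH x _; case: s IH => [|b s] IH.
  by exists a; rewrite ?mem_head// => y; rewrite inE => /eqP ->.
have [m ms mmin] := IH b (mem_head _ _).
have [am|ma] := leP (f a) (f m).
  exists a; rewrite ?mem_head// => y; rewrite inE => /predU1P[->//|/mmin].
  exact: le_trans.
exists m; first by rewrite inE ms orbT.
by move=> y; rewrite inE => /predU1P[->|/mmin//]; exact: ltW.
Qed.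

Lemma near_finite_forall (T I : Type) (F : set_system T) {FF : Filter F}
    (A : set I) (P : I -> T -> Prop) :
  finite_set A -> (forall i, A i -> \forall x \near F, P i x) ->
  \forall x \near F, forall i, A i -> P i x.
Proof.
elim/Pchoice : I => I in A P *; move=> finA FP.
have := @filter_bigI T I (fset_set A) P F FF.
move=> /(_ _)/wrap[i|]; first by rewrite in_fset_set// inE; exact: FP.
apply: filterS => x H i Ai; apply: H.
by rewrite /= in_fset_set// inE.
Qed.

(** * Nearest lattice points *)

Definition nearest (R : realType) (k : nat) (L : set 'rV[R]_k) (x : 'rV[R]_k) :
    set 'rV[R]_k :=
  [set m | L m /\ forall l, L l -> sqdist x m <= sqdist x l].

(* x lies in the cell of m iff m is nearest to x (voronoi_nearest), so this is
   the union of the boundaries of the cells. *)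
Definition skeleton (R : realType) (k : nat) (L : set 'rV[R]_k) :
    set 'rV[R]_k :=
  [set x | exists m m', [/\ nearest L x m, nearest L x m' & m != m']].

Section Lattice.
Variables (R : realType) (k : nat) (L : set 'rV[R]_k).
Hypothesis latL : is_lattice L.
Implicit Types (x y z l m p q : 'rV[R]_k).

Lemma lattice0 : L 0.
Proof. by case: latL => -[/set_mem]. Qed.

Lemma latticeB l m : L l -> L m -> L (l - m).
Proof.
by case: latL => -[_ LB] _ _ Ll Lm; apply/set_mem/LB; exact: mem_set.
Qed.

Lemma latticeN l : L l -> L (- l).
Proof. by move=> Ll; rewrite -sub0r; apply: latticeB => //; exact: lattice0. Qed.

Lemma latticeD l m : L l -> L m -> L (l + m).
Proof. by move=> Ll Lm; rewrite -(opprK m); apply: latticeB => //; exact: latticeN. Qed.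

Lemma lattice_sep : exists2 e : R, 0 < e & forall l, L l -> `|l| < e -> l = 0.
Proof.
case: latL => _ /(_ _ lattice0)[_ [V /nbhs_ballP[e /= e0 eV] VL]] _.
exists e => // l Ll le; have : (V `&` L) l.
  by split=> //; apply: eV; rewrite -ball_normE/= /ball_/= sub0r normrN.
by rewrite VL.
Qed.

(** The ball is compact, so finitely many balls of radius [e / 2] cover it, and each of them holds
    at most one lattice point. *)
Lemma lattice_bounded_finite (r : R) : finite_set (L `&` [set l | `|l| <= r]).
Proof.
have [e e0 sep] := lattice_sep.
pose K : set 'rV[R]_k := [set x | `|x| <= r].
have : compact K by exact: norm_ball_compact.
rewrite compact_cover => covK.
have [x _|x Kx|D _ KD] := covK _ setT (fun x => ball x (e / 2)).
- exact: ball_open.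
- by exists x => //; apply: ballxx; rewrite divr_gt0.
pose g x : 'rV[R]_k := xget 0 (L `&` ball x (e / 2)).
have : finite_set (g @` [set` D]) by exact: finite_image.
apply: sub_finite_set.
move=> l [Ll /KD[x Dx xl]]; exists x => //.
rewrite /g; case: xgetP => [y _ [Ly xy]|/(_ l)[]//].
apply/eqP; rewrite -subr_eq0; apply/eqP/sep; first exact: latticeB.
move: xl xy; rewrite -!ball_normE/= => xl xy.
rewrite (_ : y - l = (x - l) - (x - y)); last by rewrite opprB [RHS]addrC addrA subrK.
by apply: le_lt_trans (ler_normB _ _) _; lra.
Qed.

(** The squared sup norm is at most [dotv], which is at most [k] times it; this bounds the norm of
    [x - l] by [k.+1] times that of [x], and the triangle inequality adds one more. *)
Lemma nearest_norm x l : sqdist x l <= sqdist x 0 -> `|l| <= k.+2%:R * `|x|.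
Proof.
rewrite /sqdist subr0 => H.
have : `|x - l| ^+ 2 <= (k.+1%:R * `|x|) ^+ 2.
  apply: le_trans (sqr_norm_le_dotvv _) _; apply: le_trans H _.
  apply: le_trans (dotvv_le_sqr_norm _) _.
  rewrite -[leLHS]mulr_natl exprMn ler_wpM2r// ?sqr_ge0//.
  by rewrite -natrX ler_nat (leq_trans (leqnSn k))// -[leqLHS]expn1 leq_pexp2l.
rewrite ler_pXn2r ?nnegrE ?mulr_ge0// => xl.
rewrite -[l](subrK x); apply: le_trans (ler_normD _ _) _.
by rewrite distrC -[in leRHS]natr1 mulrDl mul1r lerD.
Qed.

(** Lattice points farther from [x] than 0 cannot win, and only finitely many others remain. *)
Lemma nearest_exists x : exists m, nearest L x m.
Proof.
pose A := L `&` [set l | `|l| <= k.+2%:R * `|x|].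
have fA : finite_set A by exact: lattice_bounded_finite.
have A0 : 0 \in fset_set A.
  by rewrite in_fset_set// inE; split; [exact: lattice0|rewrite /= normr0 mulr_ge0].
have [m mA mmin] := seq_argmin (sqdist x) A0.
exists m; split; first by move: mA; rewrite in_fset_set// inE => -[].
move=> l Ll; have [lx|/ltW lx] := leP (sqdist x l) (sqdist x 0).
  by apply: mmin; rewrite in_fset_set// inE; split => //; exact: nearest_norm.
by apply: le_trans lx; exact: mmin.
Qed.

Lemma nearest_le_norm x m : nearest L x m -> `|m| <= k.+2%:R * `|x|.
Proof. by move=> [_ /(_ _ lattice0)]; exact: nearest_norm. Qed.

Lemma nearest_finite x : finite_set (nearest L x).
Proof.
apply: sub_finite_set (lattice_bounded_finite (k.+2%:R * `|x|)) => m xm.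
by split; [case: xm|exact: nearest_le_norm].
Qed.

(** A lattice point not nearest to [x] loses strictly to another one, and by continuity still loses
    near [x]; boundedness leaves finitely many candidates. *)
Lemma nearest_usc x : \forall y \near x, nearest L y `<=` nearest L x.
Proof.
pose A := L `&` [set l | `|l| <= k.+2%:R * (`|x| + 1)].
have HA : \forall y \near x, forall m, A m -> nearest L y m -> nearest L x m.
  apply: (@near_finite_forall _ _ (nbhs x) _ A
    (fun m y => nearest L y m -> nearest L x m)).
    exact: lattice_bounded_finite.
  move=> m [Lm _].
  have [xm|xm] := pselect (nearest L x m); first exact: nearW.
  have [l Ll lm] : exists2 l, L l & sqdist x l < sqdist x m.
    apply: contrapT => H; apply: xm; split => // l Ll.
    by rewrite leNgt; apply/negP => lm; apply: H; exists l.
  have csub q : continuous (fun y : 'rV[R]_k => y - q).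
    by move=> y; exact: (cvgB cvg_id (cvg_cst _)).
  have c q : continuous (fun y : 'rV[R]_k => sqdist y q).
    exact: dotv_continuous.
  have : \forall y \near x, 0 < sqdist y m - sqdist y l.
    have /cvgr_gt : sqdist y m - sqdist y l @[y --> x] --> sqdist x m - sqdist x l.
      exact: (cvgB (c m x) (c l x)).
    by apply; rewrite subr_gt0.
  apply: filterS => y yl [_ /(_ _ Ll)].
  by rewrite leNgt -subr_gt0 yl.
have Hn : \forall y \near x, `|y| <= `|x| + 1.
  have /cvgr_le : `|y| @[y --> x] --> `|x| by exact: norm_continuous.
  by apply; rewrite ltrDl.
apply: filterS2 HA Hn => y HA yx m ym.
apply: HA => //; split; first by case: ym.
by apply: le_trans (nearest_le_norm ym) _; rewrite ler_wpM2l.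
Qed.

Lemma nearest_translate x m l : L l -> nearest L x m -> nearest L (x + l) (m + l).
Proof.
move=> Ll [Lm H]; split; first exact: latticeD.
move=> q Lq; have := H _ (latticeB Lq Ll).
by rewrite /sqdist opprB (addrA x l) opprD addrACA subrr addr0.
Qed.

Lemma skeleton_translate x l : L l -> skeleton L x -> skeleton L (x + l).
Proof.
move=> Ll [m [m' [xm xm' mm']]]; exists (m + l), (m' + l).
by split; [exact: nearest_translate..|rewrite (inj_eq (addIr _))].
Qed.

Lemma voronoi_nearest x m :
  L m -> (exists2 v, voronoi L v & v + m = x) <-> nearest L x m.
Proof.
move=> Lm; split=> [[v vV <-]|[_ xm]].
  have v0 : nearest L v 0.
    split; first exact: lattice0.
    by move=> l Ll; rewrite -enorm_le subr0; exact: vV.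
  by rewrite -[X in nearest L _ X]add0r; exact: nearest_translate.
exists (x - m); rewrite ?subrK// => l Ll.
rewrite -addrA -opprD enorm_le; apply: xm; exact: latticeD.
Qed.

(** Closedness of the skeleton, needed when passing to a limit point: by [nearest_usc], two nearest
    points of a nearby [y] are nearest to [x] as well. *)
Lemma skeleton_near x : ~ skeleton L x -> \forall y \near x, ~ skeleton L y.
Proof.
move=> Sx; have := nearest_usc x; apply: filterS => y yx [m [m' [ym ym' mm']]].
by apply: Sx; exists m, m'; split => //; exact: yx.
Qed.

Lemma nearest0_halfspace x l : nearest L x 0 -> L l -> dotv x l <= dotv l l / 2.
Proof.
move=> [_ x0] Ll; have := sqdistB x 0 l; have := x0 _ Ll.
rewrite dotv0 subr0; lra.
Qed.

(** The half-spaces of the vectors of a spanning family and of their opposites bound the products of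
    these vectors with [x], and the coordinates of [x] are fixed combinations of such products. *)
Lemma nearest0_bounded : exists r : R, forall x, nearest L x 0 -> `|x| <= r.
Proof.
case: latL => _ _ [X XL spanX].
pose c (j : 'I_k) (i : 'I_(size X)) : R := coord (in_tuple X) i (delta_mx 0 j).
exists (\sum_j \sum_i `|c j i| * (dotv X`_i X`_i / 2)) => x x0.
have XP (i : 'I_(size X)) : L X`_i by apply: XL => /=; exact: mem_nth.
have t0 j : 0 <= \sum_i `|c j i| * (dotv X`_i X`_i / 2).
  by apply: sumr_ge0 => i _; rewrite mulr_ge0// divr_ge0// dotvv_ge0.
apply: norm_leP => [|j]; first exact: sumr_ge0.
rewrite (bigD1 j)//= ler_wpDr ?sumr_ge0//.
have -> : x 0 j = \sum_i c j i * dotv X`_i x.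
  rewrite -dotv_suml -(coord_span (X := in_tuple X)) ?spanX ?memvf//.
  rewrite /dotv (bigD1 j)//= big1 => [|i ij]; first by rewrite mxE !eqxx mul1r addr0.
  by rewrite mxE (negbTE ij) andbF mul0r.
apply: le_trans (ler_norm_sum _ _ _) _; apply: ler_sum => i _.
rewrite normrM ler_wpM2l// ler_norml dotvC nearest0_halfspace// andbT.
have := nearest0_halfspace x0 (latticeN (XP i)); rewrite !dotvE; lra.
Qed.

End Lattice.

(** * Refinability and hyperplanes in the skeleton *)

(** For [q] other than [l], the squared distance to [q] minus that to [l] is affine along the
    segment, nonnegative at [x] and positive at [l]. *)
Lemma nearest_toward (R : realType) (k : nat) (L : set 'rV[R]_k)
    (x l : 'rV[R]_k) (t : R) :
  0 < t < 1 -> nearest L x l ->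
  nearest L (x + t *: (l - x)) `<=` [set l].
Proof.
move=> /andP[t0 t1] [Ll xl] q [Lq /(_ _ Ll)]; rewrite -subr_le0 sqdistB => A /=.
apply/eqP/negPn/negP => ql.
have : 0 < dotv (l - q) (l - q) by rewrite dotvv_gt0// subr_eq0 eq_sym.
have := xl _ Lq; rewrite -subr_ge0 sqdistB => B C.
have t1' : 0 <= 1 - t by lra.
have := mulr_ge0 t1' B; have := mulr_gt0 t0 C; move: A.
rewrite !dotvE (dotvC q l); nra.
Qed.

Lemma near_ray (R : realType) (k : nat) (x v : 'rV[R]_k) (A : set 'rV[R]_k) :
  nbhs x A -> \forall t \near (0 : R), A (x + t *: v).
Proof.
move=> xA.
have : x + t *: v @[t --> (0 : R)] --> x + 0 *: v.
  by apply: cvgD; [exact: cvg_cst|apply: cvgZr_tmp; exact: cvg_id].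
by rewrite scale0r addr0; apply.
Qed.

Lemma near0_gt0 (R : realType) (P : R -> Prop) :
  (\forall t \near (0 : R), P t) -> exists t : R, 0 < t < 1 /\ P t.
Proof.
move=> P0; have : \forall t \near (0 : R)^'+, 0 < t < 1 /\ P t.
  near=> t; split; last by near: t; exact: cvg_within.
  apply/andP; split; first by near: t; exact: nbhs_right_gt.
  by near: t; exact: nbhs_right_lt.
by move=> /filter_ex[t ?]; exists t.
Unshelve. all: by end_near. Qed.

Lemma near_translate (R : realType) (k : nat) (x z : 'rV[R]_k) (A : set 'rV[R]_k) :
  nbhs (x + z) A -> \forall y \near x, A (y + z).
Proof.
move=> xA; have : y + z @[y --> x] --> x + z.
  exact: (cvgD cvg_id (cvg_cst _)).
exact.
Qed.

Lemma near_scale (R : realType) (k : nat) (x : 'rV[R]_k) (a : R) (A : set 'rV[R]_k) :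
  nbhs (a *: x) A -> \forall y \near x, A (a *: y).
Proof.
move=> xA; have : a *: y @[y --> x] --> a *: x.
  exact: (cvgZl_tmp cvg_id).
exact.
Qed.

Section Refinement.
Variables (R : realType) (k : nat) (L : set 'rV[R]_k).
Hypothesis latL : is_lattice L.
Implicit Types (x y z l m p q : 'rV[R]_k).

Lemma nearest_interior x q (A : set 'rV[R]_k) : nearest L x q -> nbhs x A ->
  exists y, \forall z \near y, A z /\ nearest L z `<=` [set q].
Proof.
move=> xq /nbhs_interior/(near_ray (q - x))/near0_gt0[t [t01 tA]].
exists (x + t *: (q - x)).
apply: filterS2 tA (nearest_usc latL (x + t *: (q - x))) => z Az zt; split => //.
by apply: subset_trans zt _; exact: nearest_toward.
Qed.

(** If [lambda^-1 *: x] had only one nearest point [m], the combination would be constant near [x],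
    equal to the coefficient of the small cell of [m]. But [x] lies in two cells, and open sets near
    [x] inside each of them force this constant to be both 1 and 0. *)
Lemma skeleton_dilate : refinable (tessellation L) ->
  exists2 lambda : R, 0 < lambda < 1 &
    forall x, skeleton L x -> skeleton L (lambda^-1 *: x).
Proof.
move=> [lambda [l01 ref]]; exists lambda => // x [l [l' [xl xl' ll']]].
have l0 : lambda != 0 by rewrite gt_eqF//; case/andP: l01.
apply: contrapT => Sx.
have [m xm] := nearest_exists latL (lambda^-1 *: x).
have Lm : L m by case: xm.
have Ll : L l by case: xl.
pose cell q := [set v + q | v in voronoi L].
pose scell q := [set lambda *: v | v in cell q].
have cellE q y : L q -> cell q y <-> nearest L y q.
  by move=> Lq; exact: voronoi_nearest.
have xU : \forall y \near x, nearest L (lambda^-1 *: y) `<=` [set m].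
  apply: (@near_scale _ _ x lambda^-1 (fun y => nearest L y `<=` [set m])).
  have := nearest_usc latL (lambda^-1 *: x); apply: filterS => y yx q /yx xq /=.
  by apply/eqP/negPn/negP => qm; apply: Sx; exists q, m.
have Tl : tessellation L (cell l) by exists l.
have [a aeq] := ref _ Tl.
have sumE y : nearest L (lambda^-1 *: y) `<=` [set m] ->
    \sum_(d \in scale_tess lambda (tessellation L)) a d * \1_d y = a (scell m).
  move=> ym; rewrite -(@fsbig_widen _ _ _ _ [set scell m]); first last.
  - move=> d [[_ [q Lq <-] <-] dm] /=; rewrite indicE memNset ?mulr0// => -[z qz zy].
    apply: dm => /=; congr scell; apply: ym.
    by rewrite -zy scalerA mulVf// scale1r; apply/cellE.
  - by move=> _ ->; exists (cell m) => //; exists m.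
  rewrite fsbig_set1 indicE mem_set ?mulr1//.
  have [q yq] := nearest_exists latL (lambda^-1 *: y).
  exists (lambda^-1 *: y); last by rewrite scalerA divff// scale1r.
  by apply/cellE => //; rewrite -(ym _ yq).
(* Both sides are constant on an open set near [x] inside the cell of [q]; were the constants
   different, this open set would be null. *)
have key q (b : R) : nearest L x q ->
    (forall y, nearest L y `<=` [set q] -> \1_(cell l) y = b) -> a (scell m) = b.
  move=> xq qb; apply/eqP/negPn/negP => ab.
  have [y yq] := nearest_interior xq xU.
  apply: (nbhs_not_lebesgue_null _ aeq (x := y)).
  apply: filterS yq => z [zm zq] /=.
  by rewrite sumE// (qb z zq) eq_sym.
have a1 : a (scell m) = 1.
  apply: (key l) => // y yl; rewrite indicE mem_set//; apply/cellE => //.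
  by have [q yq] := nearest_exists latL y; rewrite -(yl _ yq).
have a0 : a (scell m) = 0.
  apply: (key l') => // y yl; rewrite indicE memNset// => /cellE => /(_ Ll) /yl.
  by move=> /= E; move/eqP: ll'.
by move: a0; rewrite a1 => /eqP; rewrite oner_eq0.
Qed.

(** The pairs in [s] are hyperplanes, a normal with an offset. They are left one at a time by a
    small step orthogonal to [l]; those already left have open complement, so a small enough step
    does not return to them. *)
Lemma generic_point (l x : 'rV[R]_k) (s : seq ('rV[R]_k * R)) :
  (forall wc, wc \in s -> exists z, dotv z l = 0 /\ dotv z wc.1 != 0) ->
  forall A : set 'rV[R]_k, nbhs x A -> exists y, dotv (y - x) l = 0 /\
    \forall y' \near y, A y' /\ forall wc, wc \in s -> dotv y' wc.1 != wc.2.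
Proof.
elim: s => [|[w c] s IH] ws A xA.
  exists x; rewrite subrr dot0v; split => //.
  by apply: filterS xA => y Ay; split.
have [wc wcs|y [yl yA]] := IH _ A xA; first by apply: ws; rewrite inE wcs orbT.
have wopen (y' : 'rV[R]_k) : dotv y' w != c -> \forall y'' \near y', dotv y'' w != c.
  have cw : continuous (fun y : 'rV[R]_k => dotv y w).
    by apply: dotv_continuous; [move=> ?; exact: cvg_id|exact: cst_continuous].
  move=> y'w; apply: (cw y' [set a | a != c]).
  by apply: open_nbhs_nbhs; split => //; exact: open_neq.
suff [y' [y'l y'A y'w]] : exists y', [/\ dotv (y' - x) l = 0,
    (\forall y'' \near y', A y'' /\ forall wc, wc \in s -> dotv y'' wc.1 != wc.2)
    & dotv y' w != c].
  exists y'; split => //; apply: filterS2 y'A (wopen _ y'w) => z [Az zs] zw.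
  by split => // wc; rewrite inE => /predU1P[->//|]; exact: zs.
have [ywc|ywc] := eqVneq (dotv y w) c; last by exists y.
have [z [zl zw]] := ws _ (mem_head _ _).
move: yA => /nbhs_interior/(near_ray z)/near0_gt0[t [/andP[t0 _] tA]].
exists (y + t *: z); split => //.
  by rewrite addrAC dotvDl yl dotvZl zl mulr0 addr0.
by rewrite dotvDl dotvZl ywc -subr_eq0 addrAC subrr add0r mulf_neq0// gt_eqF.
Qed.

(** The component of [w] orthogonal to [l] is orthogonal to [w] too, hence to itself. *)
Lemma parallelP l w : l != 0 ->
  (forall z, dotv z l = 0 -> dotv z w = 0) -> exists t, w = t *: l.
Proof.
move=> l0 lw; exists (dotv w l / dotv l l); apply/eqP; rewrite -subr_eq0; apply/eqP.
set z := _ - _.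
have zl : dotv z l = 0.
  rewrite /z !dotvE divfK ?subrr// gt_eqF// dotvv_gt0//.
apply: dotvv_eq0; rewrite {2}/z dotvDr dotvNr dotvZr zl lw// mulr0 subr0//.
Qed.

(* Near x every point has its nearest lattice points among those of x, so if no
   difference of two of them were parallel to l, a generic nearby point of the
   hyperplane would lie on none of their bisectors. *)
Lemma skeleton_hyperplane x l : l != 0 ->
  (forall z, dotv z l = 0 -> skeleton L (x + z)) ->
  exists p p' t, [/\ nearest L x p, nearest L x p', p != p' & p' - p = t *: l].
Proof.
move=> l0 xS; apply: contrapT => H.
pose F := fset_set (nearest L x).
have FE p : (p \in F) -> nearest L x p.
  by rewrite in_fset_set ?inE//; exact: nearest_finite.
have EF p : nearest L x p -> p \in F.
  by move=> ?; rewrite in_fset_set ?inE//; exact: nearest_finite.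
(* The bisectors of all pairs of distinct lattice points nearest to [x]. *)
pose s := [seq (pp.2 - pp.1, (dotv pp.2 pp.2 - dotv pp.1 pp.1) / 2) |
  pp <- [seq (p, p') | p <- F, p' <- F] & pp.1 != pp.2].
have [wc|y [yl /nbhs_singleton[yx ys]]] := generic_point (l := l) (s := s) _
    (nearest_usc latL x).
  move=> /mapP[[p p']]; rewrite mem_filter => /andP[/= pp'].
  move=> /allpairsP[[q q']] /= [/FE xq /FE xq' [? ?]] ->; subst q q' => /=.
  (* A normal [p' - p] vanishing on everything orthogonal to [l] would be a multiple of [l], which
     [H] excludes. *)
  apply: contrapT => nz; apply: H; exists p, p'.
  have [|t tE] := @parallelP l (p' - p) l0; last by exists t.
  move=> z zl; apply/eqP/negPn/negP => zp; apply: nz; by exists z.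
have := xS _ yl; rewrite addrC subrK => -[p [p' [yp yp' pp']]].
have : (p' - p, (dotv p' p' - dotv p p) / 2) \in s.
  apply/mapP; exists (p, p') => //; rewrite mem_filter/= pp'/=.
  apply/allpairsP; exists (p, p') => /=; split => //; apply: EF; exact: yx.
move=> /ys/negP; apply; apply/eqP => /=.
have [[Lp ypm] [Lp' ypm']] := (yp, yp').
have := sqdistB y p p'; have := ypm _ Lp'; have := ypm' _ Lp; lra.
Qed.

(* x - p lies in the cell V of 0 and its component along l is t/2 times l, while V
   lies between the bisector of 0, l and that of 0, -l. *)
Lemma parallel_le1 x p l (t : R) : L l -> l != 0 -> t != 0 ->
  nearest L x p -> nearest L x (p + t *: l) -> `|t| <= 1.
Proof.
move=> Ll l0 t0 xp xp'.
have Lp : L p by case: xp.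
have Ltl : L (t *: l).
  rewrite (_ : t *: l = p + t *: l - p); last by rewrite addrAC subrr add0r.
  by apply: latticeB => //; case: xp'.
have := nearest_translate latL (latticeN latL Lp) xp; rewrite subrr => v0.
have := nearest_translate latL (latticeN latL Lp) xp'.
rewrite addrAC subrr add0r => v1.
have l_gt0 := dotvv_gt0 l0.
have vl : dotv (x - p) l = t * dotv l l / 2.
  have := sqdistB (x - p) 0 (t *: l).
  have [[_ /(_ _ Ltl) A] [_ /(_ _ (lattice0 latL)) B]] := (v0, v1).
  rewrite dotv0 !subr0 !dotvZr dotvZl => C.
  apply: (mulfI t0); lra.
have := nearest0_halfspace v0 Ll; rewrite vl.
have := nearest0_halfspace v0 (latticeN latL Ll).
rewrite !dotvNr dotvNl opprK vl.
rewrite ler_norml => A B; apply/andP; split.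
  by rewrite -(ler_pM2r l_gt0); lra.
by rewrite -(ler_pM2r l_gt0); lra.
Qed.

(** Applying [parallel_le1] with [l] and then with [p' - p] as reference vector bounds both [t] and
    its inverse by 1 in absolute value. So [t] is 1 or -1, and [r] is [p] or [p'] accordingly. *)
Lemma parallel_nearest x p p' x' q l (t : R) : l != 0 ->
  nearest L x p -> nearest L x p' -> p != p' -> p' - p = t *: l ->
  nearest L x' q -> nearest L x' (q + l) ->
  exists2 r, nearest L x r & nearest L x (r + l).
Proof.
move=> l0 xp xp' pp' ptl xq xql.
have Ll : L l.
  rewrite (_ : l = q + l - q); last by rewrite addrAC subrr add0r.
  by apply: latticeB => //; [case: xql|case: xq].
have t0 : t != 0.
  apply: contra_neq pp' => t0; apply/esym/eqP.
  by rewrite -subr_eq0 ptl t0 scale0r.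
have p'E : p' = p + t *: l by rewrite -ptl addrC subrK.
have t1 : `|t| <= 1 by apply: (parallel_le1 Ll l0 t0 xp); rewrite -p'E.
have Lpp : L (p' - p) by apply: latticeB => //; [case: xp'|case: xp].
have tV1 : `|t^-1| <= 1.
  apply: (parallel_le1 Lpp) xq _; rewrite ?invr_eq0//.
    by rewrite subr_eq0 eq_sym.
  by rewrite ptl scalerA mulVf// scale1r.
have {t1 tV1} : `|t| = 1.
  apply/eqP; rewrite eq_le t1/=; move: tV1.
  by rewrite normfV invf_le1// normr_gt0.
move=> /eqP; rewrite eqr_norml => /andP[/orP[]/eqP tE _].
  by exists p => //; move: xp'; rewrite p'E tE scale1r.
by exists p' => //; rewrite p'E tE scaleN1r subrK.
Qed.

End Refinement.

(** * Facets *)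

Section Facets.
Variables (R : realType) (k : nat).
Implicit Types (x y z l m p q u v : 'rV[R]_k) (A : set 'rV[R]_k).

Lemma sub_affine_hull A : A `<=` affine_hull A.
Proof.
move=> x Ax; exists 1, (fun=> 1), (fun=> x).
by split => //; rewrite big_ord1 ?scale1r.
Qed.

Lemma affine_hull_hyperplane A u (b : R) :
  (forall y, A y -> dotv y u = b) -> forall x, affine_hull A x -> dotv x u = b.
Proof.
move=> Ab x [n [t [y [Ay t1 ->]]]]; rewrite dotv_suml.
under eq_bigr => i _ do rewrite Ab//.
by rewrite -mulr_suml t1 mul1r.
Qed.

Lemma affine_hull_neq0 A x : affine_hull A x -> exists y, A y.
Proof.
move=> [[|n] [t [y [Ay t1 _]]]]; last by exists (y ord0).
by move: t1; rewrite big_ord0 => /esym/eqP; rewrite oner_eq0.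
Qed.

Lemma affine_hull_translate A l :
  affine_hull [set x + l | x in A] = [set x + l | x in affine_hull A].
Proof.
apply/seteqP; split => [_ [n [t [y [Ay t1 ->]]]]|_ [_ [n [t [y [Ay t1 ->]]]] <-]].
  exists (\sum_i t i *: (y i - l)); last first.
    under eq_bigr do rewrite scalerBr.
    by rewrite sumrB -scaler_suml t1 scale1r subrK.
  exists n, t, (fun i => y i - l); split => // i.
  by have [z Az <-] := Ay i; rewrite addrK.
exists n, t, (fun i => y i + l); split => // [i|]; first by exists (y i).
under [RHS]eq_bigr do rewrite scalerDr.
by rewrite big_split/= -scaler_suml t1 scale1r.
Qed.

(** A [z] orthogonal to [l] and outside [U] would complete [U] to the whole space, making [l]
    orthogonal to itself. *)
Lemma hyperplane_full (U : {vspace 'rV[R]_k}) l :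
  l != 0 -> (\dim U).+1 = k -> (forall v, v \in U -> dotv v l = 0) ->
  forall z, dotv z l = 0 -> z \in U.
Proof.
move=> l0 dU Ul z zl; apply/negPn/negP => zU.
have zN0 : z != 0 by apply: contraNneq zU => ->; exact: mem0v.
have : (U + <[z]>)%VS = fullv.
  apply/eqP; rewrite eqEdim subvf/= dimvf/dim/= mul1n -{1}dU.
  rewrite dimv_disjoint_sum ?dim_vline ?zN0 ?addn1//.
  apply/eqP; rewrite -subv0; apply/subvP => v; rewrite memv_cap memv0.
  move=> /andP[vU /vlineP[a va]]; apply/negPn/negP => v0.
  move/negP: zU; apply; rewrite -[z](@scalerK _ _ a).
    by rewrite -va memvZ.
  by apply: contra_neq v0; rewrite va => ->; rewrite scale0r.
move=> full; have : l \in (U + <[z]>)%VS by rewrite full memvf.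
move=> /memv_addP[v vU [_ /vlineP[a ->] lE]].
move: l0; rewrite (@dotvv_eq0 _ _ l) ?eqxx// {1}lE dotvDl dotvZl zl mulr0 addr0.
exact: Ul.
Qed.

Variable L : set 'rV[R]_k.
Hypothesis latL : is_lattice L.

Lemma facet_translate f l : L l -> facets (tessellation L) f ->
  facets (tessellation L) [set x + l | x in f].
Proof.
move=> Ll [c [m Lm <-] [[u [b [cb fE]]] [d [p [U [dU hU]]] dk]]].
exists [set v + (m + l) | v in voronoi L].
  by exists (m + l) => //; exact: latticeD.
split; last first.
  exists d => //; exists (p + l), U; split => //.
  rewrite affine_hull_translate hU; apply/seteqP; split => [_ [x xU <-]|x xU].
    by rewrite /= opprD addrACA subrr addr0.
  by exists (x - l); rewrite ?subrK//= -addrA -opprD (addrC l).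
exists u, (b + dotv u l); split.
  by move=> _ [v vV <-]; rewrite addrA dotvDr lerD2r; apply: cb; exists v.
rewrite fE; apply/seteqP; split => [_ [x [[v vV <-] vb] <-]|x [[v vV <-]]] /=.
  by split; [exists v => //; rewrite addrA|rewrite dotvDr vb].
rewrite addrA dotvDr => /addIr vb.
by exists (v + m) => //; split => //; exists v.
Qed.

(** The squared distance to [q] minus that to [m] is affine, nonnegative at [x] and [y], and at most
    0 at their midpoint, so it vanishes at both ends. *)
Lemma nearest_mid x y m q : nearest L x m -> nearest L y m ->
  nearest L (2^-1 *: (x + y)) q -> nearest L x q /\ nearest L y q.
Proof.
move=> [Lm xm] [_ ym] [Lq /(_ _ Lm) mq].
have := sqdistB (2^-1 *: (x + y)) q m; have := sqdistB x q m; have := sqdistB y q m.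
have := xm _ Lq; have := ym _ Lq; rewrite !dotvE => A B C D E.
have xq : sqdist x q = sqdist x m by lra.
have yq : sqdist y q = sqdist y m by lra.
by split; split => // l Ll; [rewrite xq; exact: xm|rewrite yq; exact: ym].
Qed.

Lemma nearest_convex x y m : nearest L x m -> nearest L y m ->
  nearest L (2^-1 *: (x + y)) m.
Proof.
move=> [Lm xm] [_ ym]; split => // l Ll.
have := sqdistB (2^-1 *: (x + y)) m l; have := sqdistB x m l; have := sqdistB y m l.
have := xm _ Ll; have := ym _ Ll; rewrite !dotvE; lra.
Qed.

(* A point with fewest nearest lattice points: by nearest_mid, moving to the
   midpoint with another point of f can only lose some of them. *)
Lemma minimal_nearest (f : set 'rV[R]_k) m :
  f !=set0 -> (forall x, f x -> nearest L x m) ->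
  (forall x y, f x -> f y -> f (2^-1 *: (x + y))) ->
  exists2 x, f x & forall y, f y -> nearest L x `<=` nearest L y.
Proof.
move=> [x fx] fm fmid.
have [n] := ubnP #|` fset_set (nearest L x)|%fset.
elim: n x fx => // n IH x fx; rewrite ltnS => xn.
have [|/existsNP[y /not_implyP[fy /existsNP[q /not_implyP[xq yq]]]]] :=
  pselect (forall y, f y -> nearest L x `<=` nearest L y); first by exists x.
apply: (IH (2^-1 *: (x + y))); first exact: fmid.
apply: leq_trans xn; apply: fproper_ltn_card.
have mid p := @nearest_mid x y m p (fm _ fx) (fm _ fy).
rewrite fproperE; apply/andP; split.
  apply/fsubsetP => p; rewrite !in_fset_set ?inE; try exact: nearest_finite.
  by move=> /mid[].
apply/negP => /fsubsetP/(_ q); rewrite !in_fset_set ?inE; try exact: nearest_finite.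
by move=> /(_ xq)/mid[].
Qed.

Lemma bisectorP x m q :
  sqdist x m = sqdist x q <-> dotv x (q - m) = (dotv q q - dotv m m) / 2.
Proof. by have := sqdistB x m q => E; split => H; lra. Qed.

(** The midpoints of [m, m'] and of [m, q] lie on the common bisector; adding the two equations
    gives [dotv (q - m') (q - m') = 0]. *)
Lemma bisector_inj m m' q : m != m' ->
  (forall x, sqdist x m = sqdist x m' <-> sqdist x m = sqdist x q) -> q = m'.
Proof.
move=> mm' H.
have /H/bisectorP A : sqdist (2^-1 *: (m + m')) m = sqdist (2^-1 *: (m + m')) m'.
  by apply/bisectorP; rewrite !dotvE (dotvC m' m); lra.
have /H/bisectorP B : sqdist (2^-1 *: (m + q)) m = sqdist (2^-1 *: (m + q)) q.
  by apply/bisectorP; rewrite !dotvE (dotvC q m); lra.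
apply/eqP; rewrite -subr_eq0; apply/eqP/dotvv_eq0; move: A B.
rewrite !dotvE (dotvC m' m) (dotvC q m) (dotvC m' q); lra.
Qed.

(** At a point [x0] of [f] with fewest nearest points, each nearest [r] other than [m] is nearest on
    all of [f]. By dimension the hull of [f] is then the bisector of [m] and [r], which determines
    [r]. *)
Lemma facetP f : facets (tessellation L) f -> exists m m' x0,
  [/\ m != m',
      forall x, f x <-> nearest L x m /\ nearest L x m',
      affine_hull f = [set x | sqdist x m = sqdist x m'],
      f x0 & nearest L x0 `<=` [set m; m'] ].
Proof.
move=> [c [m Lm <-] [[u [b [cb fE]]] [d [p [U [dU hU]]] dk]]].
have cE x : [set v + m | v in voronoi L] x <-> nearest L x m.
  exact: voronoi_nearest.
have f0 : f !=set0.
  by apply: (@affine_hull_neq0 _ p); rewrite hU/= subrr mem0v.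
have fm x : f x -> nearest L x m by rewrite fE => -[/cE].
have fb x : f x -> dotv x u = b by rewrite fE dotvC => -[_].
have fI x : nearest L x m -> dotv x u = b -> f x.
  by move=> xm xb; rewrite fE; split; [exact/cE|rewrite /= dotvC].
have [|x0 fx0 x0min] := @minimal_nearest f m f0 fm.
  move=> x y fx fy; apply: fI; first by apply: nearest_convex; exact: fm.
  by rewrite dotvZl dotvDl !fb//; lra.
have hullU x : affine_hull f x <-> x - p \in U by rewrite hU.
have [q x0q qm] : exists2 q, nearest L x0 q & m != q.
  apply: contrapT => H.
  have x0m : \forall y \near x0, nearest L y m.
    have := nearest_usc latL x0; apply: filterS => y yx0.
    have [q yq] := nearest_exists latL y.
    have [->//|mq] := eqVneq m q; exfalso; apply: H; exists q => //; exact: yx0.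
  (* Otherwise [x0] is interior to the cell. Since [dotv u] is maximal on the cell at [x0], it is
     constant in every direction [v], so [f] has full dimension. *)
  have xU v : v \in U.
    have [t [/andP[t0 _] [tm tNm]]] : exists t : R, 0 < t < 1 /\
        (nearest L (x0 + t *: v) m /\ nearest L (x0 + t *: - v) m).
      apply: near0_gt0; have A := near_ray v x0m; have B := near_ray (- v) x0m.
      by apply: filterS2 A B.
    have tf : f (x0 + t *: v).
      apply: fI => //.
      have /cE/cb := tm; have /cE/cb := tNm; rewrite !dotvDr !dotvZr dotvNr.
      rewrite dotvDl dotvZl (dotvC u x0) (fb x0)// (dotvC u v); lra.
    have /hullU := sub_affine_hull tf; have /hullU := sub_affine_hull fx0.
    move=> x0U tU; have := memvB tU x0U.
    rewrite opprB addrA subrK addrAC subrr add0r => /(memvZ t^-1).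
    by rewrite scalerA mulVf ?scale1r// gt_eqF.
  move: dk; rewrite -dU (_ : U = fullv) ?dimvf/dim/= ?mul1n; first by move=> /esym/n_Sn.
  by apply/vspaceP => v; rewrite memvf xU.
have hull_bis r : nearest L x0 r -> m != r ->
    affine_hull f = [set x | sqdist x m = sqdist x r].
  move=> x0r mr.
  have hr x : affine_hull f x -> dotv x (r - m) = (dotv r r - dotv m m) / 2.
    apply: affine_hull_hyperplane => y fy; apply/bisectorP.
    have [[_ ym] [_ yr]] := (fm _ fy, x0min _ fy _ x0r).
    have Lr : L r by case: x0r.
    by apply/eqP; rewrite eq_le ym//= yr.
  have ph : affine_hull f p by apply/hullU; rewrite subrr mem0v.
  apply/seteqP; split => [x /hr/bisectorP//|x /bisectorP xr]; apply/hullU.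
  apply: (@hyperplane_full U (r - m)); rewrite ?dU ?subr_eq0 1?eq_sym//.
    move=> v vU; have : affine_hull f (p + v) by apply/hullU; rewrite addrC addKr.
    by move=> /hr; rewrite dotvDl (hr p ph); lra.
  by rewrite dotvDl dotvNl xr (hr p ph) subrr.
exists m, q, x0; split => //.
- move=> x; split => [fx|[xm xq]]; first by split; [exact: fm|exact: x0min].
  apply: fI => //.
  apply: (@affine_hull_hyperplane f u b) => //.
  rewrite (hull_bis q)//=; have [[_ xm'] [_ xq']] := (xm, xq).
  by apply/eqP; rewrite eq_le xm' ?xq' //; case: xq.
- exact: hull_bis.
- move=> r x0r; have [->|mr] := eqVneq m r; [by left|right] => /=.
  apply: (@bisector_inj m) => // x.
  have : affine_hull f x <-> affine_hull f x by [].
  by rewrite {1}(hull_bis q)// {1}(hull_bis r).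
Qed.

End Facets.

(** * The bisector of a facet lies in the skeleton *)

Lemma bisector_sub_skeleton (R : realType) (k : nat) (L : set 'rV[R]_k)
    (lambda : R) (m m' x0 : 'rV[R]_k) :
  is_lattice L -> 0 < lambda < 1 ->
  (forall x, skeleton L x -> skeleton L (lambda^-1 *: x)) ->
  m != m' -> nearest L x0 m -> nearest L x0 m' ->
  nearest L x0 `<=` [set m; m'] ->
  forall y, sqdist y m = sqdist y m' -> skeleton L y.
Proof.
move=> latL /andP[l0 l1] dil mm' x0m x0m' x0mm'; set l := m' - m.
have lN0 : l != 0 by rewrite subr_eq0 eq_sym.
have eqs x p q : nearest L x p -> nearest L x q -> sqdist x p = sqdist x q.
  by move=> [Lp xp] [Lq xq]; apply/eqP; rewrite eq_le xp ?xq.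
(* Near [x0] only [m] and [m'] compete, and on their bisector they tie. *)
have x0S : \forall y \near x0, dotv (y - x0) l = 0 -> skeleton L y.
  have := nearest_usc latL x0; apply: filterS => y yx0 yl.
  have ymm' : sqdist y m = sqdist y m'.
    apply/bisectorP; move: yl; rewrite dotvDl dotvNl => /eqP.
    by rewrite subr_eq0 => /eqP ->; apply/bisectorP; exact: eqs.
  have [q yq] := nearest_exists latL y.
  have swap p p' : sqdist y p = sqdist y p' -> L p' -> nearest L y p -> nearest L y p'.
    by move=> pp' Lp' [Lp yp]; split => // r Lr; rewrite -pp'; exact: yp.
  have [Lm Lm'] : L m /\ L m' by split; [case: x0m|case: x0m'].
  exists m, m'; split => //; case: (x0mm' _ (yx0 _ yq)) => /= qE; subst q => //.
  - exact: swap yq.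
  - exact: swap yq.
have dilX n x : skeleton L x -> skeleton L (lambda ^- n *: x).
  elim: n => [|n IH] xS; first by rewrite expr0 invr1 scale1r.
  by rewrite exprS invfM -scalerA; apply: dil; exact: IH.
(* The lattice vector that brings the dilated centre back to the bounded cell of 0; the default 0
   never occurs, by [nearest_exists]. *)
pose c n := xget 0 (nearest L (lambda ^- n *: x0)).
have cP n : nearest L (lambda ^- n *: x0) (c n).
  rewrite /c; case: xgetP => // H.
  by have [q /H] := nearest_exists latL (lambda ^- n *: x0).
pose xs (n : nat) : 'rV[R]_k := lambda ^- n *: x0 - c n.
have xs0 n : nearest L (xs n) 0.
  have Lc : L (c n) by case: (cP n).
  by have := nearest_translate latL (latticeN latL Lc) (cP n); rewrite subrr.
have [r rP] := nearest0_bounded latL.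
have [y0 [_ y0cl]] : [set x : 'rV[R]_k | `|x| <= r] `&` cluster (xs @ \oo) !=set0.
  apply: norm_ball_compact; last by exists 0 => // n _; exact: rP.
have y0S z : dotv z l = 0 -> skeleton L (y0 + z).
  (* If [y0 + z] were off the closed skeleton, so would be [xs n + z] for arbitrarily large [n]. But
     [xs n + z] is a lattice translate of the dilate of [x0 + lambda ^+ n *: z], which eventually is
     in the skeleton. *)
  move=> zl; apply: contrapT => /(skeleton_near latL)/near_translate y0z.
  have xsS : \forall n \near \oo, skeleton L (xs n + z).
    have : \forall n \near \oo, skeleton L (x0 + lambda ^+ n *: z).
      have /cvg_expr cl : `|lambda| < 1 by rewrite ger0_norm ?ltW.
      have : \forall n \near \oo, dotv (x0 + lambda ^+ n *: z - x0) l = 0 ->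
          skeleton L (x0 + lambda ^+ n *: z) by exact: cl (near_ray z x0S).
      apply: filterS => n.
      by apply; rewrite addrC addKr dotvZl zl mulr0.
    apply: filterS => n /(dilX n).
    move=> /(skeleton_translate latL (latticeN latL (proj1 (cP n)))).
    rewrite scalerDr scalerA mulVf ?scale1r ?expf_neq0 ?gt_eqF//.
    by rewrite addrAC.
  by have [w [/= A B]] := y0cl (fun y => skeleton L (y + z)) _ xsS y0z; apply: B.
have [p [p' [t [y0p y0p' pp' pt]]]] := skeleton_hyperplane latL lN0 y0S.
have [q y0q y0ql] : exists2 q, nearest L y0 q & nearest L y0 (q + l).
  apply: (parallel_nearest latL lN0 y0p y0p' pp' pt x0m).
  by rewrite addrC subrK.
move=> y ymm'.
(* Translation by [m - q] takes [q, q + l] to [m, m'], hence the hyperplane through [y0] to the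
   bisector of [m, m']. *)
have Lqm : L (m - q) by apply: latticeB => //; [case: x0m|case: y0q].
have /bisectorP yl := ymm'; have /bisectorP ql := eqs _ _ _ y0q y0ql.
rewrite (_ : y = y0 + (y - (m - q) - y0) + (m - q)); last first.
  by rewrite (addrC y0) !subrK.
apply: skeleton_translate => //; apply: y0S; move: yl ql.
have -> : q + l - q = l by rewrite addrAC subrr add0r.
rewrite !dotvDl !dotvNl => -> ->.
rewrite /l !dotvE (dotvC m' m) (dotvC m' q) (dotvC m q); lra.
Qed.

Theorem corollary1 (R : realType) (k : nat) (L : set 'rV[R]_k) :
  is_lattice L ->
  refinable (tessellation L) ->
  forall f : set 'rV[R]_k, facets (tessellation L) f ->
  exists2 G : set (set 'rV[R]_k), G `<=` facets (tessellation L) &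
    affine_hull f = \bigcup_(g in G) g.
Proof.
move=> latL refL f ff.
have [m [m' [x0 [mm' fE hullE fx0 x0mm']]]] := facetP latL ff.
have [lambda l01 dil] := skeleton_dilate latL refL.
have [x0m x0m'] := (fE x0).1 fx0.
have bisS := bisector_sub_skeleton latL l01 dil mm' x0m x0m' x0mm'.
have lN0 : m' - m != 0 by rewrite subr_eq0 eq_sym.
exists [set g | facets (tessellation L) g /\ g `<=` affine_hull f].
  by move=> g [].
apply/seteqP; split => [x|x [g [_ gf] /gf]]//.
rewrite hullE => /= xmm'.
have xS z : dotv z (m' - m) = 0 -> skeleton L (x + z).
  move=> zl; apply/bisS/bisectorP.
  by rewrite dotvDl zl addr0; apply/bisectorP.
have [p [p' [t [xp xp' pp' pt]]]] := skeleton_hyperplane latL lN0 xS.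
have [q xq xql] : exists2 q, nearest L x q & nearest L x (q + (m' - m)).
  apply: (parallel_nearest latL lN0 xp xp' pp' pt x0m).
  by rewrite addrC subrK.
have Lqm : L (q - m) by apply: latticeB => //; [case: xq|case: x0m].
(* Translating back by [q - m] takes the two nearest points [q] and [q + (m' - m)] of [x] to [m] and
   [m'], which characterize [f]. *)
have fx : f (x - (q - m)).
  apply/fE; split.
    have := nearest_translate latL (latticeN latL Lqm) xq.
    by rewrite opprB (addrC q) subrK.
  have := nearest_translate latL (latticeN latL Lqm) xql.
  by rewrite opprB addrAC (addrC q) subrK addrC subrK.
exists [set y + (q - m) | y in f]; last by exists (x - (q - m)); rewrite ?subrK.
split; first exact: facet_translate.
move=> _ [y fy <-]; apply/bisectorP.
(* Both [x] and [x - (q - m)] lie on the bisector, so [q - m] is orthogonal to [m' - m] and the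
   translated facet stays in the hyperplane. *)
have hf z : f z -> dotv z (m' - m) = (dotv m' m' - dotv m m) / 2.
  by move=> fz; apply/bisectorP; have := sub_affine_hull fz; rewrite hullE.
have := hf _ fx; have := hf _ fy; have /bisectorP := xmm'.
by rewrite !dotvDl !dotvNl => -> ->; rewrite dotvDl dotvNl; lra.
Qed.
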